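(* Let $\epsilon,\delta>0$, let $l\ge 1$ and $d_0,d_1,\dots,d_l\ge 1$ be integers, and let $\mathcal F$ be the set of all functions $f:\mathbb R^{d_0}\to\mathbb R^{d_l}$ of the form $$f(\mathbf x)=\mathbf W_l\,\sigma(\mathbf W_{l-1}\cdots\sigma(\mathbf W_1\mathbf x)),\qquad \mathbf W_i\in\mathbb R^{d_i\times d_{i-1}}\ \text{ and }\ \|\mathbf W_i\|\le 1\ \text{ for all } 1\le i\le l .$$ Consider a randomly initialized $2l$-layered neural network $$g(\mathbf x)=\mathbf M_{2l}\,\sigma(\mathbf M_{2l-1}\cdots\sigma(\mathbf M_1\mathbf x)),$$ where every weight (entry of $\mathbf M_1,\dots,\mathbf M_{2l}$) is drawn independently from $U[-1,1]$ and, for $1\le i\le l$, $\mathbf M_{2i}$ has dimension $$d_i\times C\, d_{i-1}\log\frac{d_{i-1}d_i\,l}{\min\{\epsilon,\delta\}}$$ and $\mathbf M_{2i-1}$ has dimension $$C\, d_{i-1}\log\frac{d_{i-1}d_i\,l}{\min\{\epsilon,\delta\}}\times d_{i-1}.$$ Then, with probability at least $1-\delta$, for every $f\in\mathcal F$, $$\min_{\mathbf S_1,\dots,\mathbf S_{2l}}\ \sup_{\|\mathbf x\|\le 1}\ \bigl\|f(\mathbf x)-(\mathbf S_{2l}\odot\mathbf M_{2l})\,\sigma\bigl((\mathbf S_{2l-1}\odot\mathbf M_{2l-1})\cdots\sigma((\mathbf S_1\odot\mathbf M_1)\mathbf x)\bigr)\bigr\|<\epsilon ,$$ where the minimum is over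 all tuples of matrices $\mathbf S_j$ with entries in $\{0,1\}$ such that $\mathbf S_j$ has the same dimensions as $\mathbf M_j$, $1\le j\le 2l$, and the supremum is over $\mathbf x\in\mathbb R^{d_0}$.
   Context: $C$ denotes a positive absolute constant (not depending on $l$, the $d_i$, $\epsilon$ or $\delta$), and the layer widths are understood as integers. $\sigma(x)=\max\{x,0\}$ is the ReLU function, applied entrywise to vectors; it is applied after every linear map except the last one. $\odot$ is the entrywise product of matrices of the same dimensions. For vectors, $\|\cdot\|$ is the Euclidean norm; for matrices, it is the operator (spectral) norm. $U[a,b]$ is the uniform distribution on $[a,b]$.
   Formalization: The logarithm in the layer width is rounded up to an integer before multiplying by C d_{i-1} (then the product is rounded up); otherwise the claim fails for every C when l=d_0=d_1=1 and ε=δ is close to 1, where the hidden width would be at most 1. *)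

(* Defs.v *)
From HB Require Import structures.
From mathcomp Require Import all_boot all_order all_algebra.
From mathcomp Require Import all_classical all_reals all_analysis.

Set Implicit Arguments.
Unset Strict Implicit.
Unset Printing Implicit Defensive.

Import Order.TTheory GRing.Theory Num.Theory.
Import numFieldNormedType.Exports.

Local Open Scope classical_set_scope.
Local Open Scope ring_scope.

(* The norm the library puts on matrices is the entrywise maximum, so the
   Euclidean and spectral norms are defined here. *)
Definition enorm (R : realType) (n : nat) (x : 'cV[R]_n) : R :=
  Num.sqrt (\sum_i x i 0 ^+ 2).

Definition unit_ball (R : realType) (n : nat) : set 'cV[R]_n :=
  [set x | enorm x <= 1].

Definition opnorm (R : realType) (m n : nat) (A : 'M[R]_(m, n)) : R :=
  sup [set enorm (A *m x) | x in @unit_ball R n].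

Definition relu (R : realType) (m n : nat) (A : 'M[R]_(m, n)) : 'M[R]_(m, n) :=
  map_mx (fun t => Num.max t 0) A.

Definition masked (R : realType) (m n : nat)
    (S : 'M[bool]_(m, n)) (A : 'M[R]_(m, n)) : 'M[R]_(m, n) :=
  map2_mx (fun (s : bool) (a : R) => s%:R * a) S A.

(* [network W x l] is W_l σ(W_(l-1) ... σ(W_1 x)), where W_(i+1) is [W i]:
   the input of the first layer is not rectified. *)
Fixpoint network (R : realType) (d : nat -> nat)
    (W : forall i, 'M[R]_(d i.+1, d i)) (x : 'cV[R]_(d 0%N)) (l : nat) :
    'cV[R]_(d l) :=
  if l is k.+1 then
    let y := network W x k in
    W k *m (if k is 0 then y else relu y)
  else x.

(* [network2 A B x l] is M_(2l) σ(M_(2l-1) ... σ(M_1 x)), where M_(2i+1) is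
   [A i] and M_(2i+2) is [B i]; its even layers have widths d and its odd layers
   have widths n.  Layers are grouped in pairs so that the output has type
   'cV_(d l) without a cast. *)
Fixpoint network2 (R : realType) (d n : nat -> nat)
    (A : forall i, 'M[R]_(n i, d i)) (B : forall i, 'M[R]_(d i.+1, n i))
    (x : 'cV[R]_(d 0%N)) (l : nat) : 'cV[R]_(d l) :=
  if l is k.+1 then
    let y := network2 A B x k in
    B k *m relu (A k *m (if k is 0 then y else relu y))
  else x.

Definition target_class (R : realType) (d : nat -> nat) (l : nat) :
    set ('cV[R]_(d 0%N) -> 'cV[R]_(d l)) :=
  [set f | exists2 W : forall i, 'M[R]_(d i.+1, d i),
     (forall i, (i < l)%N -> opnorm (W i) <= 1) &
     f = fun x => network W x l].

Definition sup_dist (R : realType) (m n : nat)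
    (f g : 'cV[R]_m -> 'cV[R]_n) : \bar R :=
  ereal_sup [set (enorm (f x - g x))%:E | x in @unit_ball R m].

(* Smallest natural number above x (0 if x is negative). *)
Definition natceil (R : realType) (x : R) : nat :=
  Num.truncn ((Num.ceil x)%:~R : R).

(* C p log(p q l / min(eps, delta)) as an integer, where p and q are the input
   and output dimensions of the approximated layer and log is the natural
   logarithm.  The logarithm is rounded up as well as the product: if only the
   product were rounded, then for l = p = q = 1 and eps, delta close to 1 the
   width would be 1 for any fixed C, and no b max(a t, 0) is at distance less
   than 1 from the identity on [-1, 1].  In all other cases with delta < 1 (that
   is, p q l >= 2 or min(eps, delta) <= 1/2) the logarithm is at least log 2, so
   the extra rounding only changes C. *)
Definition width (R : realType) (C eps delta : R) (l p q : nat) : nat :=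
  natceil (C * p%:R *
    (natceil (ln ((p * q * l)%N%:R / Num.min eps delta)))%:R).

(* Positions of the weights of [network2]: for each i < l, an entry of [A i]
   or an entry of [B i]. *)
Definition weight (d n : nat -> nat) (l : nat) : finType :=
  {i : 'I_l & (('I_(n i) * 'I_(d i)) + ('I_(d i.+1) * 'I_(n i)))%type}.

Definition weight_val (T : Type) (d n : nat -> nat) (l : nat)
    (A : forall i, 'I_(n i) -> 'I_(d i) -> T)
    (B : forall i, 'I_(d i.+1) -> 'I_(n i) -> T) (e : weight d n l) : T :=
  match tagged e with
  | inl ab => A (tag e) ab.1 ab.2
  | inr ab => B (tag e) ab.1 ab.2
  end.

Definition mutually_independent (disp : measure_display)
    (T : measurableType disp) (R : realType) (P : probability T R)
    (I : finType) (X : I -> {RV P >-> R}) : Prop :=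
  forall (J : {set I}) (E : I -> set R),
    (forall i, i \in J -> measurable (E i)) ->
    P (\bigcap_(i in [set` J]) (X i @^-1` E i)) =
    (\prod_(i in J) P (X i @^-1` E i))%E.

Definition uniformly_distributed (disp : measure_display)
    (T : measurableType disp) (R : realType) (P : probability T R)
    (a b : R) (ab : a < b) (X : {RV P >-> R}) : Prop :=
  forall E : set R, measurable E -> distribution P X E = uniform_prob ab E.

Lemma ltN11 (R : realType) : (-1 : R) < 1.
Proof. exact: gtrN. Qed.

(* Inner probability: this does not presuppose that the event E, an uncountable
   intersection in the application, has been shown to be measurable. *)
Definition with_probability_at_least (disp : measure_display)
    (T : measurableType disp) (R : realType) (P : probability T R)
    (p : R) (E : set T) : Prop :=
  exists2 F : set T, measurable F /\ F `<=` E & (p%:E <= P F)%E.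

(* Main.v *)
Require Import Defs.
From HB Require Import structures.
From mathcomp Require Import all_boot all_order all_algebra.
From mathcomp Require Import zify ring lra.

Set Implicit Arguments.
Unset Strict Implicit.
Unset Printing Implicit Defensive.

Import Order.TTheory GRing.Theory Num.Theory.

Local Open Scope ring_scope.

(* Each entry w of a target matrix is written as a subset sum of products of an
   incoming and an outgoing weight of hidden neurons.  Since
   w t = w max(t, 0) - w max(-t, 0), neurons whose incoming weight is
   nonnegative handle the first term and the others the second one.

   The random subset sum problem is discretized: weights are replaced by the
   cells of a grid of step 1/M, so that all probabilities become counts of cell
   tuples.  Let v be the covered fraction of a window of m consecutive integers.
   A new product covers any given uncovered point with probability at least
   v/16, while v at most doubles, so convexity of 1/v shows that 1/v - 1
   decreases by the factor 31/32 in expectation.  It starts below m and is at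
   least 1/m as long as some point is uncovered; hence by Markov's inequality N
   products leave a point uncovered with probability at most m^2 (31/32)^N. *)

(** * Growth of the set of subset sums inside a window of integers *)

Section Coverage.
Variables (V : finType) (m : nat) (Z : V -> option int) (x0 : 'I_m).

(** The value [None] marks a sample that must stay unselected: it displaces nothing. *)
Definition shifts (v : V) (y x : 'I_m) : bool := Z v == Some (x%:Z - y%:Z).

Definition shift_cover (A : {set 'I_m}) (v : V) : {set 'I_m} :=
  A :|: [set x : 'I_m | [exists y in A, shifts v y x]].

(** Only sums whose partial sums all stay in the window are recorded; the head of the list is the
    newest sample. *)
Definition subset_sums (s : seq V) : {set 'I_m} :=
  foldr (fun v A => shift_cover A v) [set x0] s.

Lemma mem_subset_sums0 s : x0 \in subset_sums s.
Proof. by elim: s => [|v s IHs] /=; rewrite !inE ?IHs. Qed.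

(** Backtracking from [x]: either it was covered before the newest sample, or that sample moved a
    covered [y] to it and index [ord0] joins the set. *)
Lemma subset_sumsP (N : nat) (s : N.-tuple V) (x : 'I_m) :
  x \in subset_sums s ->
  exists2 S : {set 'I_N}, (forall k, k \in S -> Z (tnth s k)) &
    \sum_(k in S) odflt 0 (Z (tnth s k)) = x%:Z - x0%:Z.
Proof.
elim: N s x => [|N IHN] s x.
  rewrite tuple0 /= inE => /eqP ->.
  by exists set0 => [k|]; rewrite ?big_set0 ?subrr// inE.
case/tupleP: s => v s /=.
have lift_sum (S : {set 'I_N}) (F : 'I_N.+1 -> int) :
    \sum_(k in [set lift ord0 k | k in S]) F k = \sum_(k in S) F (lift ord0 k).
  by rewrite big_imset// => i j _ _; exact: lift_inj.
rewrite inE => /orP[/IHN[S SZ Ssum]|].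
  exists [set lift ord0 k | k in S].
    by move=> _ /imsetP[k kS ->]; rewrite tnthS; exact: SZ.
  by rewrite lift_sum -Ssum; apply: eq_bigr => k _; rewrite tnthS.
rewrite inE => /exists_inP[y /IHN[S SZ Ssum] /eqP Zv].
exists (ord0 |: [set lift ord0 k | k in S]).
  move=> k; rewrite inE => /orP[|/imsetP[k' k'S ->]].
    by rewrite inE => /eqP ->; rewrite tnth0 Zv.
  by rewrite tnthS; exact: SZ.
rewrite big_setU1/=; last by apply/imsetP => -[k _] /eqP; rewrite (negbTE (neq_lift _ _)).
rewrite lift_sum tnth0 Zv /=.
under eq_bigr do rewrite tnthS.
by rewrite Ssum; lia.
Qed.

Lemma card_shift_cover (A : {set 'I_m}) v : (#|A| <= #|shift_cover A v| <= 2 * #|A|)%N.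
Proof.
rewrite subset_leq_card ?subsetUl//=.
rewrite mul2n -addnn (leq_trans (leq_card_setU _ _))// leq_add2l.
(* All new points lie in the translate of [A] by the single integer [Z v]. The default of [insubd]
   concerns only translates outside the window. *)
pose f (y : 'I_m) := insubd y (absz (y%:Z + odflt 0 (Z v))).
apply: leq_trans (leq_imset_card f _); apply: subset_leq_card.
apply/subsetP => x; rewrite inE => /exists_inP[y yA /eqP Zv].
apply/imsetP; exists y => //; apply: val_inj.
rewrite /f Zv /=.
have -> : absz (y%:Z + (x%:Z - y%:Z)) = x by lia.
by rewrite val_insubd ltn_ord.
Qed.

Variable R : realFieldType.

Definition potential (A : {set 'I_m}) : R := m%:R / #|A|%:R - 1.

(** The law of the samples enters only here: each displacement between distinct window points has
    probability at least 1/(16 m). *)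
Hypothesis Zspread : forall x y : 'I_m, x != y ->
  (#|V| <= 16 * m * #|[set v | shifts v y x]|)%N.

(** Double counting of pairs (sample, newly covered point). For a fixed uncovered [x], the samples
    moving [y] to [x] form disjoint sets as [y] varies in [A], because [Z v] determines [x - y]. *)
Lemma shift_cover_gain (A : {set 'I_m}) :
  ((m - #|A|) * #|A| * #|V| <= 16 * m * \sum_v (#|shift_cover A v| - #|A|))%N.
Proof.
have -> : (\sum_v (#|shift_cover A v| - #|A|) =
           \sum_(x in ~: A) #|[set v | x \in shift_cover A v]|)%N.
  transitivity (\sum_v \sum_(x in ~: A) (x \in shift_cover A v))%N.
    apply: eq_bigr => v _.
    have -> : (#|shift_cover A v| - #|A| = #|shift_cover A v :\: A|)%N.
      by rewrite cardsD (setIidPr (subsetUl _ _)).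
    rewrite -big_mkcondr sum1_card; apply: eq_card => x.
    by rewrite !inE [RHS]unfold_in /= !inE.
  rewrite exchange_big; apply: eq_bigr => x _.
  by rewrite -big_mkcond/= sum1_card cardsE.
rewrite big_distrr/=.
apply: (@leq_trans (\sum_(x in ~: A) #|A| * #|V|)).
  by rewrite sum_nat_const -[#|~: A|](addKn #|A|) cardsC card_ord mulnA.
apply: leq_sum => x; rewrite inE => xA.
rewrite -sum_nat_const.
have -> : #|[set v | x \in shift_cover A v]| = (\sum_v (x \in shift_cover A v))%N.
  by rewrite -sum1dep_card big_mkcond.
apply: leq_trans (_ : _ <= 16 * m *
  \sum_(y in A) #|[set v | shifts v y x]|)%N _.
  rewrite big_distrr/=; apply: leq_sum => y yA.
  by apply: Zspread; apply: contraNneq xA => ->.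
rewrite leq_mul2l; apply/orP; right.
under eq_bigr do rewrite -sum1dep_card big_mkcond.
rewrite exchange_big/=; apply: leq_sum => v _.
rewrite -big_mkcondr sum1_card !inE (negbTE xA)/=.
case: exists_inP => [_|nex].
  apply/card_le1_eqP => y y'; rewrite !unfold_in => /andP[_ /eqP yE] /andP[_ /eqP].
  by rewrite yE => -[e]; apply: val_inj => /=; lia.
rewrite leqn0; apply/eqP/eq_card0 => y; apply/negP.
by rewrite unfold_in => /andP[yA Zv]; apply: nex; exists y.
Qed.

(** With a = |A|, the chord bound makes the mean drop at least m/(2 a^2) times the mean gain (m - a)
    a/(16 m), that is, 1/32 of (m - a)/a, which is the potential. *)
Lemma potential_decay (A : {set 'I_m}) : (0 < #|A|)%N ->
  \sum_v potential (shift_cover A v) <= #|V|%:R * (31 / 32) * potential A.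
Proof.
move=> A0; have Am : (#|A| <= m)%N by rewrite -[leqRHS]card_ord max_card.
have m0 : (0 < m)%N by exact: leq_trans Am.
set a : R := #|A|%:R; set M : R := m%:R.
have a0 : 0 < a by rewrite ltr0n.
have M0 : 0 < M by rewrite ltr0n.
(* 1/a' lies below the chord of t |-> 1/t over [a, 2a] *)
have chord v : potential (shift_cover A v) <=
    potential A - M / (2 * a ^+ 2) * (#|shift_cover A v| - #|A|)%N%:R.
  have /andP[c1 c2] := card_shift_cover A v.
  rewrite /potential natrB// -/a -/M; set b : R := #|_|%:R.
  have ab : a <= b by rewrite ler_nat.
  have b2a : b <= 2 * a by rewrite -natrM ler_nat.
  have b0 : 0 < b by exact: lt_le_trans ab.
  have : 0 <= M * ((b - a) * (2 * a - b)) / (2 * a ^+ 2 * b).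
    by rewrite divr_ge0 ?mulr_ge0 ?subr_ge0 ?exprn_ge0 ?(ltW a0) ?(ltW b0) ?(ltW M0).
  suff -> : M * ((b - a) * (2 * a - b)) / (2 * a ^+ 2 * b) =
     M / a - 1 - M / (2 * a ^+ 2) * (b - a) - (M / b - 1) by rewrite subr_ge0.
  by field; rewrite !gt_eqF.
apply: le_trans (ler_sum _ (fun v _ => chord v)) _.
rewrite sumrB sumr_const -mulr_sumr -natr_sum.
set G := (\sum_(v in V) _)%N.
have gain : (M - a) * a * #|V|%:R <= 16 * M * G%:R.
  by rewrite -natrB// -!natrM ler_nat; exact: shift_cover_gain.
rewrite -[potential A *+ _]mulr_natl -subr_ge0.
have -> : #|V|%:R * (31 / 32) * potential A -
    (#|V|%:R * potential A - M / (2 * a ^+ 2) * G%:R) =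
    (16 * M * G%:R - (M - a) * a * #|V|%:R) / (32 * a ^+ 2).
  by rewrite /potential -/a -/M; field; rewrite gt_eqF.
by rewrite divr_ge0 ?subr_ge0// mulr_ge0 ?exprn_ge0 ?(ltW a0).
Qed.

Lemma sum_tuple_cons (N : nat) (F : N.+1.-tuple V -> R) :
  \sum_s F s = \sum_(s : N.-tuple V) \sum_v F [tuple of v :: s].
Proof.
rewrite exchange_big pair_bigA/=.
rewrite (reindex (fun p : V * N.-tuple V => [tuple of p.1 :: p.2]))//=.
exists (fun s => (thead s, [tuple of behead s])) => [[v s] _|s _] /=.
  by congr (_, _); apply: val_inj.
by rewrite -tuple_eta.
Qed.

Lemma sum_potential (N : nat) :
  \sum_(s : N.-tuple V) potential (subset_sums s) <=
  #|V|%:R ^+ N * (31 / 32) ^+ N * m%:R.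
Proof.
elim: N => [|N IHN].
  rewrite (big_pred1 [tuple]) => [|s]; last by apply/esym/eqP; exact: tuple0.
  by rewrite !expr0 !mul1r /potential /= cards1 divr1 gerBl.
rewrite sum_tuple_cons.
apply: (@le_trans _ _ (\sum_(s : N.-tuple V)
    #|V|%:R * (31 / 32) * potential (subset_sums s))).
  apply: ler_sum => s _; apply: potential_decay.
  by apply/card_gt0P; exists x0; exact: mem_subset_sums0.
rewrite -mulr_sumr.
apply: le_trans (ler_wpM2l _ IHN) _; first by rewrite !mulr_ge0 ?invr_ge0 ?ler0n.
by rewrite !exprS le_eqVlt; apply/orP; left; apply/eqP; ring.
Qed.

Lemma card_uncovered (N : nat) :
  #|[set s : N.-tuple V | subset_sums s != [set: 'I_m]]|%:R <=
  #|V|%:R ^+ N * (31 / 32) ^+ N * m%:R ^+ 2 :> R.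
Proof.
have m0 : (0 < m)%N by case: (m) x0 => // -[].
rewrite [X in _ * X]expr2 mulrA -ler_pdivrMr ?ltr0n//.
apply: le_trans (sum_potential N).
rewrite -sum1dep_card natr_sum mulr_suml big_mkcond/=; apply: ler_sum => s _.
set A := subset_sums s.
have A0 : (0 < #|A|)%N by apply/card_gt0P; exists x0; exact: mem_subset_sums0.
have Am : (#|A| <= m)%N by rewrite -[leqRHS]card_ord max_card.
rewrite /potential; case: ifPn => AT.
  have {}Am : (#|A|.+1 <= m)%N.
    rewrite ltn_neqAle Am andbT; apply: contra AT => /eqP cA.
    by rewrite eqEcard subsetT cardsT card_ord cA /=.
  have aM : #|A|%:R + 1 <= m%:R :> R by rewrite natr1 ler_nat.
  have a0 : 0 < #|A|%:R :> R by rewrite ltr0n.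
  (* An uncovered point gives m/a - 1 = (m - a)/a >= 1/a >= 1/m, the threshold for Markov's
     inequality. *)
  rewrite lerBrDr; apply: (@le_trans _ _ (1 / #|A|%:R + 1)).
    by rewrite lerD2r !mul1r lef_pV2 ?posrE ?ltr0n// ler_nat ltnW.
  by rewrite ler_pdivlMr// mulrDl !mul1r mulVf ?gt_eqF// addrC.
by rewrite subr_ge0 ler_pdivlMr ?ltr0n// mul1r ler_nat.
Qed.
End Coverage.

(** * Products of two weights, rounded to the grid *)

Section ProductCells.
Variable M : nat.

(* Cell c is the interval [(c - M)/M, (c + 1 - M)/M), and [rev_ord c] its mirror
   image up to an endpoint, hence the cell of -x. *)
Definition sgcell (s : bool) (c : 'I_(2 * M)) : int :=
  (if s then c else rev_ord c)%:Z - M%:Z.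

(* Only incoming weights of modulus at least 1/2 are used: they stretch the outgoing
   cells enough for the rounded product to hit every small integer. *)
Definition prod_cell (s : bool) (v : 'I_(2 * M) * 'I_(2 * M)) : option int :=
  if M%:Z <= 2 * sgcell s v.1 then
    Some ((sgcell s v.1 * sgcell true v.2) %/ M%:Z)%Z
  else None.

Variable R : archiRealFieldType.

Definition in_cell (c : 'I_(2 * M)) (x : R) : bool :=
  c%:R <= (x + 1) * M%:R < c%:R + 1.

Definition sg (s : bool) : R := if s then 1 else -1.

Hypothesis M_gt0 : (0 < M)%N.

Lemma sgcell_bound s c : - M%:Z <= sgcell s c < M%:Z.
Proof. by rewrite /sgcell; case: s; have := ltn_ord c; rewrite /=; lia. Qed.

Lemma in_cell_itv c x : in_cell c x -> -1 <= x <= 1.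
Proof.
move=> /andP[cx xc]; have M0 : 0 < M%:R :> R by rewrite ltr0n.
have : 0 < (x + 1) * M%:R + 1 by rewrite ltr_wpDl// (le_trans _ cx).
have c2 : c%:R + 1 <= 2 * M%:R :> R by rewrite natr1 -natrM ler_nat ltn_ord.
have c0 : 0 <= c%:R :> R by [].
move=> _; apply/andP; split.
  by rewrite -subr_ge0 opprK -(pmulr_lge0 _ M0); lra.
by rewrite -subr_ge0 -(pmulr_lge0 _ M0); lra.
Qed.

Lemma in_cell_sg s c x : in_cell c x ->
  `|sg s * x - (sgcell s c)%:~R / M%:R| <= M%:R^-1.
Proof.
move=> /andP[cx xc]; have M0 : 0 < M%:R :> R by rewrite ltr0n.
rewrite -(ler_pM2r M0) mulVf ?gt_eqF// -{2}(gtr0_norm M0) -normrM mulrBl.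
rewrite divfK ?gt_eqF// ler_norml /sgcell /sg.
case: s; rewrite ?intrD ?intrN /=.
  by apply/andP; split; lra.
have -> : (2 * M - c.+1)%N%:~R = 2 * M%:R - c%:R - 1 :> R.
  by rewrite -pmulrn natrB ?natrM -?natr1; [ring|exact: ltn_ord].
by apply/andP; split; lra.
Qed.

(** Three errors of at most 1/M add up: rounding the incoming weight, rounding the outgoing one, and
    the integer division of their product. *)
Lemma prod_cell_approx s v z x y : prod_cell s v = Some z ->
  in_cell v.1 x -> in_cell v.2 y ->
  0 <= sg s * x /\ `|sg s * x * y - z%:~R / M%:R| <= 3 / M%:R.
Proof.
rewrite /prod_cell; case: ifP => // Ma [<-{z}] /(in_cell_sg s) xE yc.
have /in_cell_itv ylt := yc; have := in_cell_sg true yc.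
have := sgcell_bound s v.1.
set a := sgcell s v.1 in Ma xE *; set b := sgcell true v.2 => aM yE.
have M0 : 0 < M%:R :> R by rewrite ltr0n.
set i := M%:R^-1 in xE yE *.
have i0 : 0 < i by rewrite invr_gt0.
have Mi : M%:R * i = 1 by rewrite divff ?gt_eqF.
have a2 : 1 <= 2 * (a%:~R * i).
  rewrite -(ler_pM2r M0) mul1r -!mulrA [i * _]mulrC Mi mulr1.
  by rewrite pmulrn -[2]/(2%:~R) -intrM ler_int.
have a1 : a%:~R * i <= 1.
  rewrite -(ler_pM2r M0) mul1r -!mulrA [i * _]mulrC Mi mulr1 pmulrn ler_int.
  by case/andP: aM => _ /ltW.
split.
  have : M%:R^-1 * 2 <= 2 :> R.
    by rewrite -[leRHS]mul1r ler_pM2r// invf_le1// ler1n.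
  move: xE; rewrite ler_norml -/i => /andP[x1 _] i2.
  (* For [M >= 2] the cell value, at least 1/2, absorbs the rounding error 1/M. For [M = 1]
     integrality improves the lower bound on [a] to 1. *)
  case: (ltnP 1 M) => [M2|M1].
    have : 2 * i <= 1 by rewrite -[leRHS]Mi ler_pM2r// ler_nat.
    lra.
  have M1' : M = 1%N by lia.
  have : 1 <= a%:~R * i.
    by rewrite /i M1' invr1 mulr1 -[1]/(1%:~R) ler_int; move: Ma; rewrite M1'; lia.
  have : i = 1 by rewrite /i M1' invr1.
  by lra.
clearbody a b; set q := (_ %/ _)%Z.
have qE : `|a%:~R * i * (b%:~R * i) - q%:~R * i| <= i.
  have -> : a%:~R * i * (b%:~R * i) - q%:~R * i =
            (a * b - q * M%:Z)%:~R * (i * i).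
    rewrite intrB !intrM -pmulrn mulrBl; congr (_ - _); first by ring.
    by rewrite -mulrA [M%:R * _]mulrA Mi mul1r.
  have -> : a * b - q * M%:Z = ((a * b) %% M%:Z)%Z by [].
  have r0 : (0 <= (a * b) %% M%:Z)%Z by rewrite modz_ge0//; lia.
  have r1 : ((a * b) %% M%:Z <= M%:Z)%Z by rewrite ltW// ltz_pmod//; lia.
  rewrite ger0_norm; last by rewrite !mulr_ge0 ?ler0z// ltW.
  rewrite mulrA -[leRHS]mul1r ler_pM2r// -[leRHS]Mi ler_pM2r//.
  by rewrite pmulrn ler_int.
have y1 : `|y| <= 1 by rewrite ler_norml.
have -> : sg s * x * y - q%:~R * i = (sg s * x - a%:~R * i) * y +
   (a%:~R * i) * (y - b%:~R * i) + (a%:~R * i * (b%:~R * i) - q%:~R * i) by ring.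
have a0 : 0 <= a%:~R * i by lra.
have -> : 3 * i = i * 1 + 1 * i + i by ring.
apply: le_trans (ler_normD _ _) _; apply: lerD => //.
apply: le_trans (ler_normD _ _) _; rewrite 2!normrM; apply: lerD.
  by apply: ler_pM.
rewrite (ger0_norm a0); apply: ler_pM => //.
by move: yE; rewrite /sg mul1r.
Qed.

(** Starting from the middle [h], the covered window yields every sum in [-h, h), that is [-1/4,
    1/4) after division by M = 4h, which leaves room for |w| <= 1/5. The error is 3/M per product
    plus 1/M for rounding [w]. *)
Lemma batch_approx (N h : nat) (x0 : 'I_(2 * h)) (s : bool)
    (t : N.-tuple ('I_(2 * M) * 'I_(2 * M))) (x y : 'I_N -> R) (w : R) :
  M = (4 * h)%N -> x0 = h :> nat ->
  subset_sums (prod_cell s) x0 t = [set: 'I_(2 * h)] ->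
  (forall k, in_cell (tnth t k).1 (x k)) ->
  (forall k, in_cell (tnth t k).2 (y k)) ->
  `|w| <= 1 / 5 ->
  exists2 S : {set 'I_N}, (forall k, k \in S -> 0 <= sg s * x k) &
    `|\sum_(k in S) sg s * x k * y k - w| <= (3 * N%:R + 1) / M%:R.
Proof.
move=> Mh x0h cover xc yc; rewrite ler_norml => /andP[w1 w2].
have M0 : 0 < M%:R :> R by rewrite ltr0n.
have h0 : 0 < h%:R :> R by rewrite ltr0n; lia.
have MhR : M%:R = 4 * h%:R :> R by rewrite Mh natrM.
pose j := Num.floor (w * M%:R).
have jE : j%:~R <= w * M%:R < j%:~R + 1 by have := floor_itv (w * M%:R); rewrite intrD.
have jh : - h%:Z <= j < h%:Z.
  apply/andP; split.
    rewrite floor_ge_int intrN -pmulrn MhR; nra.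
  rewrite -(ltr_int R) -pmulrn; case/andP: jE => jw _; nra.
have jx : (absz (j + h%:Z)%R < 2 * h)%N by lia.
have : Ordinal jx \in subset_sums (prod_cell s) x0 t by rewrite cover inE.
move=> /subset_sumsP[S SZ Ssum]; exists S.
  move=> k /SZ; case E : (prod_cell s _) => [z|]// _.
  by have [] := prod_cell_approx E (xc k) (yc k).
have {}Ssum : \sum_(k in S) odflt 0 (prod_cell s (tnth t k)) = j.
  by rewrite Ssum x0h /=; lia.
have -> : \sum_(k in S) sg s * x k * y k - w =
  \sum_(k in S) (sg s * x k * y k - (odflt 0 (prod_cell s (tnth t k)))%:~R / M%:R)
  + (j%:~R / M%:R - w).
  by rewrite sumrB -mulr_suml -Ssum rmorph_sum /=; ring.
rewrite mulrDl; apply: le_trans (ler_normD _ _) _; apply: lerD.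
  apply: le_trans (ler_norm_sum _ _ _) _.
  apply: (@le_trans _ _ (\sum_(k in S) 3 / M%:R)).
    apply: ler_sum => k /SZ; case E : (prod_cell s _) => [z|]// _.
    by have [] := prod_cell_approx E (xc k) (yc k).
  rewrite sumr_const -[_ *+ #|_|]mulr_natl mulrA ler_pM2r ?invr_gt0//.
  rewrite mulrC ler_pM2l// ler_nat.
  by rewrite -[leqRHS]card_ord max_card.
have -> : j%:~R / M%:R - w = (j%:~R - w * M%:R) / M%:R by field; rewrite gt_eqF.
rewrite normrM normfV (gtr0_norm M0) ler_pM2r ?invr_gt0//.
by rewrite ler_norml; apply/andP; split; lra.
Qed.

End ProductCells.

(** With M = 2m, each of the m incoming values a in [m, 2m) has a partner b = ceil(M j / a): then M
    j <= a b < M j + a <= M (j + 1), so the rounded product is j. This gives m of the 16 m^2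
    pairs. *)
Lemma prod_cell_spread (m : nat) (s : bool) (x y : 'I_m) :
  (#|{: 'I_(2 * (2 * m)) * 'I_(2 * (2 * m))}| <=
   16 * m * #|[set v | shifts (@prod_cell (2 * m) s) v y x]|)%N.
Proof.
rewrite card_prod !card_ord.
have m0 : (0 < m)%N by case: (m) x => // -[].
set j := x%:Z - y%:Z.
have jm : - m%:Z < j < m%:Z by have := ltn_ord x; have := ltn_ord y; lia.
(* Negating before and after the floor division yields the ceiling. *)
pose b (i : 'I_m) : int := - ((- (2 * m%:Z * j)) %/ (m + i)%:Z)%Z.
have bE (i : 'I_m) : (2 * m)%:Z * j <= (m + i)%:Z * b i < (2 * m)%:Z * (j + 1).
  have a0 : (m + i)%:Z != 0 by lia.
  have := divz_eq (- (2 * m%:Z * j)) (m + i)%:Z.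
  have := modz_ge0 (- (2 * m%:Z * j)) a0.
  have := ltz_pmod (- (2 * m%:Z * j)) (_ : 0 < (m + i)%:Z).
  have := ltn_ord i; rewrite /b; set q := (_ %/ _)%Z; set r := (_ %% _)%Z.
  by move=> im /(_ ltac:(lia)); nia.
have bm (i : 'I_m) : - (2 * m)%:Z <= b i < (2 * m)%:Z.
  have := bE i; have := ltn_ord i => im; nia.
have aP (i : 'I_m) : (3 * m + i < 2 * (2 * m))%N by have := ltn_ord i; lia.
have bP (i : 'I_m) : (absz (b i + (2 * m)%:Z)%R < 2 * (2 * m))%N.
  have := bm i; lia.
pose a i := if s then Ordinal (aP i) else rev_ord (Ordinal (aP i)).
pose f i := (a i, Ordinal (bP i)).
have fI : injective f.
  move=> i i' [] + _; rewrite /a; case: (s) => [[]|/rev_ord_inj[]] e;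
    by apply: val_inj => /=; lia.
have : (#|f @: [set: 'I_m]| <= #|[set v | shifts (@prod_cell (2 * m) s) v y x]|)%N.
  apply: subset_leq_card; apply/subsetP => _ /imsetP[i _ ->]; rewrite inE.
  have ai : sgcell s (a i) = (m + i)%:Z.
    rewrite /sgcell /a; case: (s) => /=; have := ltn_ord i; lia.
  have bi : sgcell true (Ordinal (bP i)) = b i.
    rewrite /sgcell /=; have := bm i; lia.
  rewrite /shifts /prod_cell ai bi; case: ifPn => [_|]; last lia.
  rewrite -/j; apply/eqP; congr Some.
  have m20 : (2 * m)%:Z != 0 by lia.
  have := divz_eq ((m + i)%:Z * b i) (2 * m)%:Z.
  have := modz_ge0 ((m + i)%:Z * b i) m20.
  have := ltz_pmod ((m + i)%:Z * b i) (_ : 0 < (2 * m)%:Z).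
  have := bE i; set q := (_ %/ _)%Z; set r := (_ %% _)%Z.
  by move=> + /(_ ltac:(lia)); nia.
rewrite card_imset// cardsT card_ord; nia.
Qed.

(* Imported only here: the classical set notations shadow those of finset. *)
From mathcomp Require Import all_classical all_reals all_analysis.

Import numFieldNormedType.Exports.

Local Open Scope classical_set_scope.
Local Open Scope ring_scope.

(** * Union bounds for inner probability *)

Section InnerProbability.
Context (disp : measure_display) (T : measurableType disp) (R : realType)
  (P : probability T R).

Lemma with_probability_at_leastW (p q : R) (E F : set T) : q <= p -> E `<=` F ->
  with_probability_at_least P p E -> with_probability_at_least P q F.
Proof.
move=> qp EF [G [mG GE] PG]; exists G.
  by split=> //; exact: subset_trans EF.
by apply: le_trans PG; rewrite lee_fin.
Qed.

Lemma with_probability_at_leastI (a b : R) (E F : set T) :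
  with_probability_at_least P (1 - a) E ->
  with_probability_at_least P (1 - b) F ->
  with_probability_at_least P (1 - (a + b)) (E `&` F).
Proof.
move=> [E' [mE E'E] PE] [F' [mF F'F] PF]; exists (E' `&` F').
  by split; [exact: measurableI|exact: setISS].
have C A r : measurable A -> ((1 - r)%:E <= P A -> P (~` A) <= r%:E)%E.
  move=> mA; rewrite probability_setC// -(fineK (fin_num_measure P A mA)).
  by rewrite -EFinB !lee_fin; lra.
have mEF : measurable (E' `&` F') by exact: measurableI.
have : (P (~` (E' `&` F')) <= (a + b)%:E)%E.
  rewrite setCI EFinD; apply: le_trans (leeD (C _ _ mE PE) (C _ _ mF PF)).
  by apply: measureU2; exact: measurableC.
rewrite probability_setC// -(fineK (fin_num_measure P _ mEF)).
by rewrite -EFinB !lee_fin; lra.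
Qed.

Lemma with_probability_at_least_forall (I : finType) (r : I -> R)
    (E : I -> set T) :
  (forall i, with_probability_at_least P (1 - r i) (E i)) ->
  with_probability_at_least P (1 - \sum_i r i) [set w | forall i, E i w].
Proof.
move=> rE.
have: with_probability_at_least P (1 - \sum_(i <- enum I) r i)
    [set w | forall i, i \in enum I -> E i w].
  elim: (enum I) => [|i s IHs].
    rewrite big_nil subr0; exists setT => //.
    by rewrite probability_setT.
  rewrite big_cons.
  apply: with_probability_at_leastW (with_probability_at_leastI (rE i) IHs) => //.
  by move=> w [Ei Es] j; rewrite inE => /orP[/eqP ->|/Es].
rewrite big_enum/=; apply: with_probability_at_leastW => // w Ew i.
by apply: Ew; rewrite mem_enum.
Qed.

End InnerProbability.

(** * From counts of cell tuples to probabilities *)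

Section CellEvents.
Context (R : realType) (M : nat).
Hypothesis M_gt0 : (0 < M)%N.

Lemma in_cell_set (c : 'I_(2 * M)) : [set x : R | in_cell c x] =
  [set` `[c%:R / M%:R - 1, (c%:R + 1) / M%:R - 1[].
Proof.
have M0 : 0 < M%:R :> R by rewrite ltr0n.
apply/seteqP; split=> x /=; rewrite in_itv/= /in_cell.
  by rewrite lerBlDr ltrBrDr ler_pdivrMr// ltr_pdivlMr.
by rewrite lerBlDr ltrBrDr ler_pdivrMr// ltr_pdivlMr.
Qed.

Lemma measurable_in_cell (c : 'I_(2 * M)) : measurable [set x : R | in_cell c x].
Proof. by rewrite in_cell_set. Qed.

Lemma uniform_prob_in_cell (c : 'I_(2 * M)) :
  uniform_prob (ltN11 R) [set x : R | in_cell c x] = ((2 * M)%:R^-1)%:E.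
Proof.
have M0 : 0 < M%:R :> R by rewrite ltr0n.
rewrite /uniform_prob (eq_integral (fun=> (2^-1)%:E)); last first.
  move=> x; rewrite inE/= => /(in_cell_itv M_gt0) x1.
  by rewrite /uniform_pdf x1 opprK.
rewrite integral_cst/=; last exact: measurable_in_cell.
rewrite in_cell_set lebesgue_measure_itv/= lte_fin ltrD2r ltr_pM2r ?invr_gt0//.
rewrite ltrDl ltr01 -EFinB -EFinM natrM; congr EFin.
by field; rewrite gt_eqF.
Qed.

Lemma in_cell_inj (c c' : 'I_(2 * M)) (x : R) :
  in_cell c x -> in_cell c' x -> c = c'.
Proof.
move=> /andP[c1 c2] /andP[c1' c2']; apply: val_inj => /=.
have : c%:R < c'%:R + 1 :> R by exact: le_lt_trans c2'.
have : c'%:R < c%:R + 1 :> R by exact: le_lt_trans c2.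
by rewrite !natr1 !ltr_nat; lia.
Qed.

Context (disp : measure_display) (T : measurableType disp)
  (P : probability T R) (I : finType) (X : I -> {RV P >-> R}).
Hypothesis X_uniform : forall i, uniformly_distributed (ltN11 R) (X i).
Hypothesis X_independent : mutually_independent X.

Definition box (K : finType) (g : K -> I) (c : K -> 'I_(2 * M)) : set T :=
  [set w | forall k, in_cell (c k) (X (g k) w)].

Lemma measurable_box (K : finType) (g : K -> I) (c : K -> 'I_(2 * M)) :
  measurable (box g c).
Proof.
have -> : box g c = \bigcap_(k in [set: K])
    (X (g k) @^-1` [set x : R | in_cell (c k) x]).
  apply/seteqP; split => w bw k; first by move=> _; exact: bw.
  exact: (bw k Logic.I).
apply: fin_bigcap_measurable => // k _.
by apply: measurable_funPTI; exact: measurable_in_cell.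
Qed.

Lemma prob_box (K : finType) (g : K -> I) (c : K -> 'I_(2 * M)) :
  injective g -> P (box g c) = ((2 * M)%:R ^- #|K|)%:E.
Proof.
move=> gI.
(* Independence speaks of events indexed by positions, so the cells are transported along the
   injection [g]; positions outside its image get the full set. *)
pose E i : set R := if [pick k | g k == i] is Some k
  then [set x | in_cell (c k) x] else setT.
have Eg k : E (g k) = [set x | in_cell (c k) x].
  by rewrite /E; case: pickP => [k' /eqP/gI ->|/(_ k)]//; rewrite eqxx.
have -> : box g c = \bigcap_(i in [set` g @: [set: K]%SET]) (X i @^-1` E i).
  apply/seteqP; split => w bw => [_ /imsetP[k _ ->]|k].
    by rewrite /= Eg; exact: bw.
  have := bw (g k) (imset_f g (finset.in_setT k)).
  by rewrite /= Eg.
rewrite X_independent; last first.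
  move=> _ /imsetP[k _ ->]; rewrite Eg; exact: measurable_in_cell.
rewrite big_imset/=; last by move=> k k' _ _; exact: gI.
under eq_bigr => k _.
  rewrite Eg (_ : P _ = ((2 * M)%:R^-1)%:E); last first.
    rewrite -(uniform_prob_in_cell (c k)).
    by rewrite -(X_uniform (g k) (measurable_in_cell (c k))).
  over.
by rewrite prodEFin prodr_const cardsT exprVn.
Qed.

Lemma box_disjoint (K : finType) (g : K -> I) (c c' : K -> 'I_(2 * M)) :
  box g c `&` box g c' !=set0 -> c =1 c'.
Proof. by move=> [w [cw c'w]] k; exact: in_cell_inj (cw k) (c'w k). Qed.

(** Boxes of distinct tuples are disjoint and equally likely, with total mass 1, so the union of the
    good ones is a measurable witness. A weight equal to 1 lies in no cell, which is a null
    event. *)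
Lemma with_probability_at_least_boxes (N : nat) (g : 'I_N + 'I_N -> I)
    (Bad : {set N.-tuple ('I_(2 * M) * 'I_(2 * M))}) (r : R) :
  injective g ->
  #|Bad|%:R <= r * #|{: 'I_(2 * M) * 'I_(2 * M)}|%:R ^+ N ->
  with_probability_at_least P (1 - r) [set w | exists2 t, t \notin Bad &
    forall k, in_cell (tnth t k).1 (X (g (inl k)) w) /\
              in_cell (tnth t k).2 (X (g (inr k)) w)].
Proof.
move=> gI rBad.
pose c (t : N.-tuple ('I_(2 * M) * 'I_(2 * M))) (k : 'I_N + 'I_N) :=
  match k with inl k => (tnth t k).1 | inr k => (tnth t k).2 end.
exists (\bigcup_(t in [set` ~: Bad]) box g (c t)).
  split; first by apply: fin_bigcup_measurable => // t _; exact: measurable_box.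
  move=> w [t]; rewrite /= inE => tB wt; exists t => // k.
  by split; [exact: (wt (inl k))|exact: (wt (inr k))].
rewrite measure_fin_bigcup//; last 2 first.
- apply/trivIsetP => t t' _ _ tt'; apply/eqP; apply: contraNT tt' => /set0P.
  move=> /box_disjoint cc'; apply/eqP; apply: eq_from_tnth => k.
  by rewrite [LHS]surjective_pairing [RHS]surjective_pairing; congr (_, _);
     [exact: (cc' (inl k))|exact: (cc' (inr k))].
- by move=> t _; exact: measurable_box.
have -> : [set` ~: Bad] = [set` enum (~: Bad)].
  by apply/seteqP; split => t /=; rewrite mem_enum.
rewrite -fsbig_seq ?enum_uniq// big_enum/=.
under eq_bigr do rewrite prob_box//.
rewrite sumEFin lee_fin sumr_const -[_ *+ #|_|]mulr_natr cardsCs finset.setCK.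
rewrite natrB ?max_card// card_sum !card_ord.
have V0 : 0 < #|{: 'I_(2 * M) * 'I_(2 * M)}|%:R ^+ N :> R.
  by rewrite exprn_gt0// ltr0n card_prod !card_ord; lia.
have -> : (2 * M)%:R ^- (N + N) =
    (#|{: 'I_(2 * M) * 'I_(2 * M)}|%:R ^+ N)^-1 :> R.
  by rewrite card_prod !card_ord (natrM _ (2 * M)) exprMn exprD.
rewrite card_tuple natrX mulrBr mulVf ?gt_eqF// lerD2l lerN2.
by rewrite mulrC ler_pdivrMr.
Qed.

End CellEvents.

(** * Euclidean and spectral norms, and the Lipschitz bound for ReLU *)

Section EuclideanNorm.
Variable R : realType.

Lemma sqr_enorm n (x : 'cV[R]_n) : enorm x ^+ 2 = \sum_i x i 0 ^+ 2.
Proof. by rewrite sqr_sqrtr// sumr_ge0// => i _; exact: sqr_ge0. Qed.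

Lemma enorm_ge0 n (x : 'cV[R]_n) : 0 <= enorm x.
Proof. exact: sqrtr_ge0. Qed.

Lemma enorm0 n : enorm (0 : 'cV[R]_n) = 0.
Proof. by rewrite /enorm big1 ?sqrtr0// => i _; rewrite mxE expr0n. Qed.

Lemma enorm_le n (x : 'cV[R]_n) (r : R) : 0 <= r ->
  \sum_i x i 0 ^+ 2 <= r ^+ 2 -> enorm x <= r.
Proof.
move=> r0 xr.
by rewrite -(ler_pXn2r (ltn0Sn 1)) ?nnegrE ?enorm_ge0// sqr_enorm.
Qed.

Lemma le_enorm m n (x : 'cV[R]_m) (y : 'cV[R]_n) :
  \sum_i x i 0 ^+ 2 <= \sum_i y i 0 ^+ 2 -> enorm x <= enorm y.
Proof. by move=> xy; apply: enorm_le; rewrite ?enorm_ge0// sqr_enorm. Qed.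

Lemma norm_entry_le_enorm n (x : 'cV[R]_n) i : `|x i 0| <= enorm x.
Proof.
rewrite -(ler_pXn2r (ltn0Sn 1)) ?nnegrE ?enorm_ge0// sqr_enorm real_normK ?num_real//.
by rewrite (bigD1 i)//= lerDl sumr_ge0// => j _; exact: sqr_ge0.
Qed.

Lemma enormZ n (a : R) (x : 'cV[R]_n) : enorm (a *: x) = `|a| * enorm x.
Proof.
rewrite /enorm -[`|a|]sqrtr_sqr -sqrtrM ?sqr_ge0// mulr_sumr.
by congr Num.sqrt; apply: eq_bigr => i _; rewrite mxE exprMn.
Qed.

Lemma cauchy_schwarz n (x y : 'cV[R]_n) :
  \sum_i x i 0 * y i 0 <= enorm x * enorm y.
Proof.
have [x0|xn0] := eqVneq (enorm x) 0.
  rewrite x0 mul0r big1// => i _.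
  have := norm_entry_le_enorm x i; rewrite x0 normr_le0 => /eqP ->.
  by rewrite mul0r.
have [y0|yn0] := eqVneq (enorm y) 0.
  rewrite y0 mulr0 big1// => i _.
  have := norm_entry_le_enorm y i; rewrite y0 normr_le0 => /eqP ->.
  by rewrite mulr0.
set a := enorm x; set b := enorm y.
have a0 : 0 < a by rewrite lt_def xn0 enorm_ge0.
have b0 : 0 < b by rewrite lt_def yn0 enorm_ge0.
(* As a and b are the norms of x and y, this sum equals 2ab(ab - <x, y>). *)
have : 0 <= \sum_i (b * x i 0 - a * y i 0) ^+ 2.
  by apply: sumr_ge0 => i _; exact: sqr_ge0.
have -> : \sum_i (b * x i 0 - a * y i 0) ^+ 2 =
    2 * (a * b) * (a * b - \sum_i x i 0 * y i 0).
  transitivity (b ^+ 2 * (\sum_i x i 0 ^+ 2) + a ^+ 2 * (\sum_i y i 0 ^+ 2)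
      - 2 * (a * b) * (\sum_i x i 0 * y i 0)).
    rewrite !mulr_sumr -big_split -sumrB /=.
    by apply: eq_bigr => i _; ring.
  by rewrite -!sqr_enorm -/a -/b; ring.
by rewrite pmulr_rge0 ?subr_ge0// !mulr_gt0.
Qed.

Lemma enormD n (x y : 'cV[R]_n) : enorm (x + y) <= enorm x + enorm y.
Proof.
apply: enorm_le; first by rewrite addr_ge0 ?enorm_ge0.
have -> : \sum_i (x + y) i 0 ^+ 2 =
    enorm x ^+ 2 + 2 * (\sum_i x i 0 * y i 0) + enorm y ^+ 2.
  rewrite !sqr_enorm mulr_sumr -!big_split /=.
  by apply: eq_bigr => i _; rewrite mxE; ring.
have := cauchy_schwarz x y; nra.
Qed.

Lemma enorm_le_sum n (x : 'cV[R]_n) : enorm x <= \sum_i `|x i 0|.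
Proof.
have s0 : 0 <= \sum_i `|x i 0| by apply: sumr_ge0.
apply: enorm_le => //; rewrite expr2 mulr_suml; apply: ler_sum => i _.
rewrite -(real_normK (num_real (x i 0))) expr2 ler_wpM2l//.
by rewrite (bigD1 i)//= lerDl sumr_ge0.
Qed.

Lemma relu0 n : relu (0 : 'cV[R]_n) = 0.
Proof. by apply/matrixP => i j; rewrite !mxE maxxx. Qed.

Lemma enorm_relu_sub n (x y : 'cV[R]_n) :
  enorm (relu x - relu y) <= enorm (x - y).
Proof.
apply: le_enorm; apply: ler_sum => i _; rewrite !mxE.
case: (lerP (x i 0) 0) => x0; case: (lerP (y i 0) 0) => y0 //.
- by rewrite subrr expr0n sqr_ge0.
- rewrite -subr_ge0 (_ : _ - _ = - x i 0 * (2 * y i 0 - x i 0)); last by ring.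
  by apply: mulr_ge0; lra.
- rewrite -subr_ge0 (_ : _ - _ = - y i 0 * (2 * x i 0 - y i 0)); last by ring.
  by apply: mulr_ge0; lra.
Qed.

Lemma enorm_relu n (x : 'cV[R]_n) : enorm (relu x) <= enorm x.
Proof. by have := enorm_relu_sub x 0; rewrite relu0 !subr0. Qed.

Lemma opnorm_has_sup m n (A : 'M[R]_(m, n)) :
  has_sup [set enorm (A *m x) | x in @unit_ball R n].
Proof.
split; first by exists (enorm (A *m 0)), 0; rewrite // /unit_ball /= enorm0.
exists (\sum_i \sum_j `|A i j|) => _ [x x1 <-].
apply: le_trans (enorm_le_sum _) _; apply: ler_sum => i _; rewrite mxE.
apply: le_trans (ler_norm_sum _ _ _) _; apply: ler_sum => j _.
rewrite normrM ler_piMr//; exact: le_trans (norm_entry_le_enorm _ _) x1.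
Qed.

Lemma enorm_mulmx m n (A : 'M[R]_(m, n)) (x : 'cV[R]_n) :
  opnorm A <= 1 -> enorm (A *m x) <= enorm x.
Proof.
move=> A1; have [x0|xn0] := eqVneq (enorm x) 0.
  suff -> : x = 0 by rewrite mulmx0 !enorm0.
  apply/matrixP => i j; rewrite ord1 mxE; apply/eqP; rewrite -normr_le0 -x0.
  exact: norm_entry_le_enorm.
have x0 : 0 < enorm x by rewrite lt_def xn0 enorm_ge0.
have : enorm (A *m ((enorm x)^-1 *: x)) <= 1.
  apply: le_trans A1; apply: ub_le_sup; first by have [] := opnorm_has_sup A.
  exists ((enorm x)^-1 *: x) => //; rewrite /unit_ball /= enormZ.
  by rewrite ger0_norm ?invr_ge0 ?enorm_ge0// mulVf.
rewrite -scalemxAr enormZ ger0_norm ?invr_ge0 ?enorm_ge0//.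
by rewrite mulrC ler_pdivrMr// mul1r.
Qed.

(** An entry is a coordinate of the image of a standard basis vector. *)
Lemma norm_entry_le1 m n (A : 'M[R]_(m, n)) i j : opnorm A <= 1 -> `|A i j| <= 1.
Proof.
move=> A1; have -> : A i j = (A *m delta_mx j 0 : 'cV_m) i 0.
  rewrite mxE (bigD1 j)//= big1 ?mxE ?eqxx ?mulr1 ?addr0// => k kj.
  by rewrite mxE (negbTE kj) mulr0.
apply: le_trans (norm_entry_le_enorm _ _) _.
apply: le_trans (enorm_mulmx _ A1) _.
apply: le_trans (enorm_le_sum _) _.
rewrite (bigD1 j)//= big1 ?mxE ?eqxx ?normr1 ?addr0// => k kj.
by rewrite mxE (negbTE kj) normr0.
Qed.

End EuclideanNorm.

(** * Deterministic approximation of one layer by two masked layers *)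

Section Layer.
Variables (R : realType).

(** This is all that is asked of a random batch. One batch serves all targets [w] at once, which
    later makes the good event uniform over the target networks. *)
Definition subset_dense (N : nat) (eta : R) (s : bool) (x y : 'I_N -> R) : Prop :=
  forall w : R, `|w| <= 1 / 5 ->
  exists2 S : {set 'I_N}, (forall k, k \in S -> 0 <= sg R s * x k) &
    `|\sum_(k in S) sg R s * x k * y k - w| <= eta.

Lemma relu_sg (s : bool) (a t : R) : 0 <= sg R s * a ->
  Num.max (a * t) 0 = sg R s * a * Num.max (sg R s * t) 0.
Proof.
move=> a0; rewrite maxr_pMr// mulr0; congr (Num.max _ 0).
by rewrite /sg; case: s {a0}; ring.
Qed.

Lemma sum_relu_sg (t : R) : \sum_(s : bool) sg R s * Num.max (sg R s * t) 0 = t.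
Proof.
by rewrite big_bool /sg /= !mul1r !mulN1r; case: (lerP t 0); case: (lerP (-t) 0); lra.
Qed.

Lemma sum_norm_sg (t : R) : \sum_(s : bool) Num.max (sg R s * t) 0 = `|t|.
Proof.
rewrite big_bool /sg /= !mul1r !mulN1r; case: (lerP t 0) => t0.
  by rewrite ler0_norm//; case: (lerP (-t) 0); lra.
by rewrite gtr0_norm//; case: (lerP (-t) 0); lra.
Qed.

Variables (p q n N : nat).

(* A neuron serves one input coordinate, one sign of its incoming weight, and
   one of five batches, each responsible for a fifth of the target weight. *)
Definition neuron : finType := ('I_p * (bool * 'I_5) * 'I_N)%type.

(** The first mask wires each neuron to its own coordinate only and is the same for all outputs; the
    subsets are selected in the second mask, row by row. For an entry [W i j], five batches and both
    signs cost at most 5 eta |y_j|, and summing over [i] and [j] gives the bound. *)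
Lemma layer_approx (f : neuron -> 'I_n) (eta : R) (a : 'M[R]_(n, p))
    (b : 'M[R]_(q, n)) (W : 'M[R]_(q, p)) :
  injective f -> 0 <= eta ->
  (forall i j s u, subset_dense eta s
    (fun k => a (f (j, (s, u), k)) j) (fun k => b i (f (j, (s, u), k)))) ->
  (forall i j, `|W i j| <= 1) ->
  exists SAB : 'M[bool]_(n, p) * 'M[bool]_(q, n), forall y : 'cV[R]_p,
    enorm (W *m y - masked SAB.2 b *m relu (masked SAB.1 a *m y)) <=
    (p * q)%:R * (5 * eta) * enorm y.
Proof.
move=> fI eta0 dense W1.
have /choice[S SP] : forall e : 'I_q * ('I_p * (bool * 'I_5)),
    exists S : {set 'I_N}, let: (i, (j, (s, u))) := e in
     (forall k, k \in S -> 0 <= sg R s * a (f (j, (s, u), k)) j) /\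
     `|\sum_(k in S) sg R s * a (f (j, (s, u), k)) j * b i (f (j, (s, u), k))
        - sg R s * W i j / 5| <= eta.
  move=> [i [j [s u]]]; have [|S S0 Sw] := dense i j s u (sg R s * W i j / 5).
    rewrite normrM normrM [`|5^-1|]gtr0_norm// ler_pM2r//.
    by rewrite (_ : `|sg R s| = 1) ?mul1r// /sg; case: s; rewrite ?normrN normr1.
  by exists S.
pose SA : 'M[bool]_(n, p) :=
  \matrix_(k, j) [exists g : neuron, (f g == k) && (g.1.1 == j)].
pose SB : 'M[bool]_(q, n) :=
  \matrix_(i, k) [exists g : neuron, (f g == k) && (g.2 \in S (i, g.1))].
have SAf g j : SA (f g) j = (g.1.1 == j).
  rewrite mxE; apply/existsP/idP => [[g' /andP[/eqP/fI ->]]//|gj].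
  by exists g; rewrite eqxx.
have SBf i g : SB i (f g) = (g.2 \in S (i, g.1)).
  rewrite mxE; apply/existsP/idP => [[g' /andP[/eqP/fI ->]]//|gj].
  by exists g; rewrite eqxx.
(* Hidden units beyond the image of [f] are disconnected from the output. *)
have SBn i k : k \notin f @: [set: neuron]%SET -> SB i k = false.
  move=> kf; rewrite mxE; apply/existsP => -[g /andP[/eqP gk _]].
  by move: kf; rewrite -gk imset_f ?finset.in_setT.
exists (SA, SB) => y /=; clearbody SA SB.
pose z j (s : bool) : R := Num.max (sg R s * y j 0) 0.
have z0 j s : 0 <= z j s by rewrite le_max lexx orbT.
have outE i : (masked SB b *m relu (masked SA a *m y)) i 0 =
    \sum_j \sum_s \sum_u z j s * \sum_(k in S (i, (j, (s, u))))
      sg R s * a (f (j, (s, u), k)) j * b i (f (j, (s, u), k)).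
  rewrite mxE (bigID (mem (f @: [set: neuron]%SET)))/=.
  rewrite [X in _ + X]big1 ?addr0; last first.
    by move=> k kf; rewrite /masked mxE SBn// !mul0r.
  rewrite big_imset/=; last by move=> g g' _ _; exact: fI.
  under eq_bigl do rewrite inE.
  transitivity (\sum_(e : 'I_p * (bool * 'I_5)) \sum_(k in S (i, e))
      z e.1 e.2.1 * (sg R e.2.1 * a (f (e, k)) e.1 * b i (f (e, k)))); last first.
    under [RHS]eq_bigr do rewrite pair_bigA.
    by rewrite pair_bigA/=; apply: eq_bigr => -[j [s u]] _ /=; rewrite mulr_sumr.
  under [RHS]eq_bigr do rewrite big_mkcond/=.
  rewrite pair_bigA/=; apply: eq_bigr => -[[j [s u]] k] _ /=.
  rewrite /masked /relu !mxE SBf /=.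
  case: ifPn => kS; last by rewrite !mul0r.
  rewrite (bigD1 j)//= big1 ?addr0; last first.
    by move=> j' j'j; rewrite !mxE SAf /= eq_sym (negbTE j'j) !mul0r.
  rewrite !mxE SAf /= eqxx !mul1r.
  have [S0 _] := SP (i, (j, (s, u))).
  by rewrite (relu_sg _ (S0 _ kS)) /z; ring.
have diff i : `|(W *m y - masked SB b *m relu (masked SA a *m y)) i 0| <=
    p%:R * (5 * eta) * enorm y.
  rewrite mxE [X in _ + X]mxE outE mxE -sumrB.
  apply: le_trans (ler_norm_sum _ _ _) _.
  rewrite (_ : p%:R * _ * _ = \sum_(j < p) 5 * eta * enorm y); last first.
    by rewrite sumr_const card_ord -[RHS]mulr_natl -mulrA.
  apply: ler_sum => j _.
  apply: (@le_trans _ _ (5 * eta * `|y j 0|)); last first.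
    by rewrite ler_wpM2l ?mulr_ge0//; exact: norm_entry_le_enorm.
  have -> : W i j * y j 0 = \sum_s \sum_(u < 5) z j s * (sg R s * W i j / 5).
    rewrite -{1}(sum_relu_sg (y j 0)) mulr_sumr; apply: eq_bigr => s _.
    by rewrite sumr_const card_ord -[RHS]mulr_natl -/(z j s); field.
  rewrite -sumrB -sum_norm_sg mulr_sumr.
  apply: le_trans (ler_norm_sum _ _ _) _; apply: ler_sum => s _.
  rewrite -sumrB; apply: le_trans (ler_norm_sum _ _ _) _.
  rewrite (_ : 5 * eta * _ = \sum_(u < 5) eta * Num.max (sg R s * y j 0) 0); last first.
    by rewrite sumr_const card_ord -[RHS]mulr_natl mulrA.
  apply: ler_sum => u _.
  rewrite -mulrBr normrM ger0_norm// -/(z j s) mulrC ler_wpM2r// distrC.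
  by have [] := SP (i, (j, (s, u))).
apply: le_trans (enorm_le_sum _) _.
apply: le_trans (ler_sum _ (fun i _ => diff i)) _.
by rewrite sumr_const card_ord -[leLHS]mulr_natl natrM [p%:R * q%:R]mulrC !mulrA.
Qed.

End Layer.

(** * Propagation of the layer errors through the network *)

Section Networks.
Variable R : realType.

Lemma enorm_input n (k : nat) (x y : 'cV[R]_n) :
  enorm ((if k is 0 then x else relu x) - (if k is 0 then y else relu y)) <=
  enorm (x - y).
Proof. by case: k => [//|k]; exact: enorm_relu_sub. Qed.

Lemma enorm_input0 n (k : nat) (x : 'cV[R]_n) :
  enorm (if k is 0 then x else relu x) <= enorm x.
Proof. by case: k => [//|k]; exact: enorm_relu. Qed.

(** Neither ReLU nor a matrix of norm at most 1 amplifies the earlier error. As the accumulated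
    error stays below 1, the inputs of the masked layers have norm at most 2, so each layer adds at
    most 2e. *)
Lemma network_approx (d n : nat -> nat) (l : nat) (e : R)
    (W : forall i, 'M[R]_(d i.+1, d i))
    (A : forall i, 'M[R]_(n i, d i)) (B : forall i, 'M[R]_(d i.+1, n i))
    (x : 'cV[R]_(d 0%N)) (k : nat) :
  0 <= e -> l%:R * (2 * e) <= 1 ->
  (forall i, (i < l)%N -> opnorm (W i) <= 1) ->
  (forall i, (i < l)%N -> forall y,
     enorm (W i *m y - B i *m relu (A i *m y)) <= e * enorm y) ->
  enorm x <= 1 -> (k <= l)%N ->
  enorm (network W x k) <= 1 /\
  enorm (network W x k - network2 A B x k) <= k%:R * (2 * e).
Proof.
move=> e0 le1 W1 We x1; elim: k => [|k IHk] kl /=.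
  by rewrite subrr enorm0 mul0r.
have {IHk}[y1 yd] := IHk (ltnW kl).
set y := network W x k in y1 yd *; set y' := network2 A B x k in yd *.
have := enorm_input k y y'; have := enorm_input0 k y.
set u := (X in enorm X <= _); set u' := (X in _ - X) => uy uu'.
have {uy}u1 : enorm u <= 1 by exact: le_trans y1.
split; first by apply: le_trans u1; exact: enorm_mulmx (W1 _ kl).
have {uu' yd}ud : enorm (u - u') <= k%:R * (2 * e) by exact: le_trans yd.
have kl1 : k%:R * (2 * e) <= 1.
  by apply: le_trans le1; rewrite ler_wpM2r ?mulr_ge0// ler_nat ltnW.
have u'2 : enorm u' <= 2.
  have -> : u' = u + (-1) *: (u - u') by rewrite scaleN1r opprB addrC subrK.
  apply: le_trans (enormD _ _) _; rewrite enormZ normrN1 mul1r; lra.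
have -> : W k *m u - B k *m relu (A k *m u') =
    W k *m (u - u') + (W k *m u' - B k *m relu (A k *m u')).
  by rewrite mulmxBr addrA subrK.
apply: le_trans (enormD _ _) _.
rewrite -natr1 mulrDl mul1r; apply: lerD.
  by apply: le_trans ud; exact: enorm_mulmx (W1 _ kl).
apply: le_trans (We _ kl _) _; rewrite mulrC ler_wpM2r//.
Qed.

End Networks.

(** * Numerical estimates behind the width *)

Section Constants.
Variable R : realType.

Lemma natceil_ge (x : R) : x <= (natceil x)%:R.
Proof.
rewrite /natceil; apply: le_trans (ceil_ge x) _.
case: (Num.ceil x) => k; first by rewrite -pmulrn natrK.
by apply: (@le_trans _ _ 0); rewrite ?ler0n// lerz0.
Qed.

(** From 1 + x <= e^x at x = -1/2 follows e^(1/2) <= 2. The crude base 4 keeps the later bounds in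
    powers of two. *)
Lemma expR1_le4 : expR 1 <= 4 :> R.
Proof.
have h : 2^-1 <= expR (- 2^-1) :> R.
  by apply: le_trans (expR_ge1Dx _); lra.
have <- : expR (2 * 2^-1) = expR 1 :> R by rewrite mulfV.
rewrite expRM_natl.
have : expR 2^-1 <= 2 :> R.
  by move: h; rewrite expRN lef_pV2 ?posrE ?expR_gt0.
move=> e2; have -> : 4 = 2 ^+ 2 :> R by ring.
by rewrite ler_pXn2r ?nnegrE ?expR_ge0.
Qed.

Lemma log_width (x : R) : 1 < x ->
  (0 < natceil (ln x))%N /\ x <= 4 ^+ natceil (ln x).
Proof.
move=> x1; have lx : 0 < ln x by exact: ln_gt0.
have xL := natceil_ge (ln x).
have L0 : (0 < natceil (ln x))%N by rewrite -(ltr0n R); exact: lt_le_trans xL.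
split=> //.
have x0 : 0 < x by exact: lt_trans x1.
rewrite -{1}(lnK x0); apply: (@le_trans _ _ (expR (natceil (ln x))%:R)).
  by rewrite ler_expR.
rewrite -[_%:R]mulr1 expRM_natl ler_pXn2r ?nnegrE ?expR_ge0//.
exact: expR1_le4.
Qed.

(** Five squarings, with the bound rounded up to hundredths each time. *)
Lemma decay_bound : (31 / 32) ^+ 32 <= 2^-1 :> R.
Proof.
have sq (x y z : R) : 0 <= x <= y -> y ^+ 2 <= z -> 0 <= x ^+ 2 <= z.
  move=> /andP[x0 xy] yz; rewrite sqr_ge0/=; apply: le_trans yz.
  by rewrite ler_pXn2r ?nnegrE// (le_trans x0).
have h1 : 0 <= (31 / 32 : R) <= 97 / 100 by lra.
have h2 := sq _ _ (95 / 100) h1 ltac:(lra).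
have h4 := sq _ _ (91 / 100) h2 ltac:(lra).
have h8 := sq _ _ (83 / 100) h4 ltac:(lra).
have h16 := sq _ _ (69 / 100) h8 ltac:(lra).
have /andP[_] := sq _ _ (1 / 2) h16 ltac:(lra).
by rewrite -!exprM mul1r.
Qed.

Lemma expr_pow2 (k L : nat) : (2 ^ k)%N%:R ^+ L = (2 ^+ L) ^+ k :> R.
Proof. by rewrite natrX -!exprM mulnC. Qed.

(* (31/32)^32 <= 1/2, so 1536 L = 32 * 48 L products win a factor 2^(48 L)
   against the squared window size 2^34 64^L and the target 1/(10 4^L). *)
Lemma uncovered_bound (L : nat) : (0 < L)%N ->
  (31 / 32) ^+ (1536 * L) * (2 * (2 ^ 16 * 8 ^ L))%N%:R ^+ 2 <=
  (10 * 4 ^+ L)^-1 :> R.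
Proof.
move=> L0; pose p : R := 2 ^+ L.
have p2 : 2 <= p by rewrite -[leLHS]expr1 ler_eXn2l// ltr1n.
have p0 : 0 < p by exact: lt_le_trans p2.
have -> : 4 ^+ L = p ^+ 2 :> R by rewrite -(expr_pow2 2).
have -> : (2 * (2 ^ 16 * 8 ^ L))%N%:R = 2 ^+ 17 * p ^+ 3 :> R.
  by rewrite mulnA -expnS natrM !natrX -(expr_pow2 3).
have d : (31 / 32) ^+ (1536 * L) <= (p ^+ 48)^-1 :> R.
  rewrite (_ : 1536 * L = 32 * (L * 48))%N; last by lia.
  rewrite [_ ^+ (32 * _)]exprM -[p ^+ 48]exprM -exprVn.
  by apply: lerXn2r; rewrite ?nnegrE ?exprn_ge0 ?invr_ge0 ?divr_ge0// decay_bound.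
apply: le_trans (ler_wpM2r _ d) _; first by rewrite exprn_ge0// mulr_ge0 ?exprn_ge0// ltW.
rewrite [leLHS]mulrC ler_pdivrMr ?exprn_gt0//.
rewrite [leRHS]mulrC ler_pdivlMr ?mulr_gt0 ?exprn_gt0//.
have p40 : 2 ^+ 40 <= p ^+ 40 by rewrite ler_pXn2r ?nnegrE// ltW.
have -> : p ^+ 48 = p ^+ 40 * p ^+ 8 by rewrite -exprD.
have -> : (2 ^+ 17 * p ^+ 3) ^+ 2 * (10 * p ^+ 2) = (10 * 2 ^+ 34) * p ^+ 8 by ring.
rewrite ler_pM2r ?exprn_gt0//; apply: le_trans p40.
lra.
Qed.

(** The number of products is linear in L <= 2^L while the grid is finer than 8^-L, so their total
    error is of order 4^-L. *)
Lemma accuracy_bound (L : nat) :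
  (3 * (1536 * L)%N%:R + 1) / (2 * (2 * (2 ^ 16 * 8 ^ L)))%N%:R <=
  (20 * 4 ^+ L)^-1 :> R.
Proof.
pose p : R := 2 ^+ L.
have Lp : L%:R <= p by rewrite /p -natrX ler_nat ltnW// ltn_expl.
have p1 : 1 <= p by rewrite exprn_ege1// ler1n.
have p0 : 0 < p by exact: lt_le_trans p1.
have -> : 4 ^+ L = p ^+ 2 :> R by rewrite -(expr_pow2 2).
have -> : (2 * (2 * (2 ^ 16 * 8 ^ L)))%N%:R = 2 ^+ 18 * p ^+ 3 :> R.
  by rewrite [(2 * (2 ^ 16 * _))%N]mulnA -expnS mulnA -expnS natrM !natrX -(expr_pow2 3).
rewrite natrM ler_pdivrMr ?mulr_gt0 ?exprn_gt0//.
rewrite [leRHS]mulrC ler_pdivlMr ?mulr_gt0 ?exprn_gt0//.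
have -> : 2 ^+ 18 * p ^+ 3 = 2 ^+ 18 * p * p ^+ 2 by ring.
rewrite [leLHS]mulrA ler_pM2r ?exprn_gt0//.
lra.
Qed.

End Constants.

(** * Success probability of a batch and of a layer *)

Section RandomLayers.
Context (R : realType) (disp : measure_display) (T : measurableType disp)
  (P : probability T R).

Lemma batch_probability (I : finType) (X : I -> {RV P >-> R}) (L : nat)
    (s : bool) (g : 'I_(1536 * L) + 'I_(1536 * L) -> I) :
  (forall i, uniformly_distributed (ltN11 R) (X i)) ->
  mutually_independent X -> (0 < L)%N -> injective g ->
  with_probability_at_least P (1 - (10 * 4 ^+ L)^-1)
    [set w | subset_dense (20 * 4 ^+ L)^-1 s
      (fun k => X (g (inl k)) w) (fun k => X (g (inr k)) w)].
Proof.
move=> Xu Xi L0 gI.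
have h0 : (0 < 2 ^ 16 * 8 ^ L)%N by rewrite muln_gt0 !expn_gt0.
have := @uncovered_bound R _ L0; have := @accuracy_bound R L.
move: (2 ^ 16 * 8 ^ L)%N h0 => h h0 acc unc.
have x0P : (h < 2 * h)%N by lia.
pose x0 := Ordinal x0P.
(* The grid has M = 4h and the window 2h points, as [batch_approx] and [prod_cell_spread] both
   require. *)
pose Bad := [set t : (1536 * L).-tuple ('I_(2 * (2 * (2 * h))) * 'I_(2 * (2 * (2 * h)))) |
  subset_sums (@prod_cell (2 * (2 * h)) s) x0 t != [set: 'I_(2 * h)]%SET]%SET.
have M0 : (0 < 2 * (2 * h))%N by lia.
have Bad_small : #|Bad|%:R <= (10 * 4 ^+ L)^-1 *
    #|{: 'I_(2 * (2 * (2 * h))) * 'I_(2 * (2 * (2 * h)))}|%:R ^+ (1536 * L) :> R.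
  apply: le_trans (card_uncovered x0 R _ (1536 * L)) _.
    by move=> x y _; exact: prod_cell_spread.
  by rewrite -mulrA [leRHS]mulrC ler_wpM2l ?exprn_ge0.
apply: with_probability_at_leastW
  (with_probability_at_least_boxes M0 Xu Xi gI Bad_small) => //.
move=> w [t]; rewrite inE negbK => /eqP cover tw v v5.
have [|||||S S0 Sv] := @batch_approx _ R M0 _ h x0 s t
   (fun k => X (g (inl k)) w) (fun k => X (g (inr k)) w) v _ _ cover.
- by lia.
- by [].
- by move=> k; have [] := tw k.
- by move=> k; have [] := tw k.
- by [].
by exists S => //; exact: le_trans Sv acc.
Qed.

(** A union bound over the 10 batches of each matrix entry turns the failure probability 1/(10 4^L)
    into d_i d_(i+1)/4^L; likewise 5 times the batch accuracy 1/(20 4^L) is 1/(4 4^L). *)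
Lemma layer_probability (l : nat) (d n : nat -> nat)
    (A : forall i, 'I_(n i) -> 'I_(d i) -> {RV P >-> R})
    (B : forall i, 'I_(d i.+1) -> 'I_(n i) -> {RV P >-> R})
    (i : 'I_l) (L : nat) :
  (forall e : weight d n l, uniformly_distributed (ltN11 R) (weight_val A B e)) ->
  mutually_independent (@weight_val _ d n l A B) ->
  (0 < L)%N -> (15 * 1024 * d i * L <= n i)%N ->
  with_probability_at_least P (1 - (d i * d i.+1)%:R / 4 ^+ L)
    [set w | forall W : 'M[R]_(d i.+1, d i), opnorm W <= 1 ->
      exists SAB : 'M[bool]_(n i, d i) * 'M[bool]_(d i.+1, n i),
      forall y : 'cV[R]_(d i),
        enorm (W *m y - masked SAB.2 (\matrix_(a, b) B i a b w) *m
                 relu (masked SAB.1 (\matrix_(a, b) A i a b w) *m y)) <=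
        (d i * d i.+1)%:R / (4 * 4 ^+ L) * enorm y].
Proof.
move=> AB_uniform AB_independent L0 dn.
have cn : (#|neuron (d i) (1536 * L)| <= n i)%N.
  apply: leq_trans dn; rewrite !card_prod !card_ord card_bool.
  by nia.
pose f (e : neuron (d i) (1536 * L)) := widen_ord cn (enum_rank e).
have fI : injective f by move=> e e' [] /val_inj/enum_rank_inj.
clearbody f.
pose J : finType := ('I_(d i.+1) * 'I_(d i) * (bool * 'I_5))%type.
(* Batches for different outputs share their incoming weights; the union bound tolerates this, and
   within one batch all positions are distinct. *)
pose g (e : J) (k : 'I_(1536 * L) + 'I_(1536 * L)) : weight d n l :=
  Tagged (fun i : 'I_l => (('I_(n i) * 'I_(d i)) + ('I_(d i.+1) * 'I_(n i)))%type)
  match k with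
  | inl k => inl (f (e.1.2, e.2, k), e.1.2)
  | inr k => inr (e.1.1, f (e.1.2, e.2, k))
  end.
have gI e : injective (g e).
  move=> k k' /eqP; rewrite eq_Tagged /= => /eqP.
  by case: k => k; case: k' => k' // [] /fI[->].
have := with_probability_at_least_forall
  (fun e : J => batch_probability e.2.1 AB_uniform AB_independent L0 (@gI e)).
apply: with_probability_at_leastW.
  rewrite sumr_const !card_prod !card_ord card_bool -[_ *+ _]mulr_natl.
  rewrite lerD2l lerN2 le_eqVlt !natrM; apply/orP; left; apply/eqP.
  by field; rewrite expf_neq0.
move=> w wd W W1.
have [|i' j s u|i' j|SAB SABP] := @layer_approx R (d i) (d i.+1) (n i) (1536 * L) f
  (20 * 4 ^+ L)^-1 (\matrix_(a, b) A i a b w) (\matrix_(a, b) B i a b w) W fI.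
- by rewrite invr_ge0 mulr_ge0 ?exprn_ge0.
- have := wd ((i', j), (s, u)).
  congr (subset_dense _ _ _ _); apply/funext => k; rewrite mxE //.
- exact: norm_entry_le1.
exists SAB => y; apply: le_trans (SABP y) _.
rewrite ler_wpM2r ?enorm_ge0// le_eqVlt; apply/orP; left; apply/eqP.
by field; rewrite expf_neq0.
Qed.

End RandomLayers.

(** With m = min(eps, delta), each layer pair fails with probability at most m/l and otherwise has
    relative error at most m/(4l). Summing gives failure probability at most m <= delta and total
    error at most m/2 < eps. *)
Theorem theorem1 (R : realType) :
  exists2 C : R, 0 < C &
  forall (eps delta : R) (l : nat) (d n : nat -> nat),
  0 < eps -> 0 < delta -> (1 <= l)%N ->
  (forall i, (i <= l)%N -> (1 <= d i)%N) ->
  (forall i, (i < l)%N -> n i = width C eps delta l (d i) (d i.+1)) ->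
  forall (disp : measure_display) (T : measurableType disp)
    (P : probability T R)
    (A : forall i, 'I_(n i) -> 'I_(d i) -> {RV P >-> R})
    (B : forall i, 'I_(d i.+1) -> 'I_(n i) -> {RV P >-> R}),
  (forall e : weight d n l,
     uniformly_distributed (ltN11 R) (weight_val A B e)) ->
  mutually_independent (@weight_val _ d n l A B) ->
  with_probability_at_least P (1 - delta)
    [set w | forall f : 'cV[R]_(d 0%N) -> 'cV[R]_(d l),
      target_class f ->
      exists (SA : forall i, 'M[bool]_(n i, d i))
             (SB : forall i, 'M[bool]_(d i.+1, n i)),
        (sup_dist f (fun x => network2
           (fun i => masked (SA i) (\matrix_(a, b) A i a b w))
           (fun i => masked (SB i) (\matrix_(a, b) B i a b w)) x l)
         < eps%:E)%E].
Proof.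
(* This is 10 times 1536: two signs, five batches and 1536 L neurons per batch for each input
   coordinate. *)
exists (15 * 1024)%:R; first by rewrite ltr0n.
move=> eps delta l d n eps0 delta0 l0 d0 nE disp T P A B AB_u AB_i.
(* For [delta >= 1] the empty event suffices. Otherwise [m < 1], so the argument of the logarithm
   exceeds 1. *)
have [delta1|delta1] := leP 1 delta.
  exists set0; first by split.
  by rewrite measure0 lee_fin subr_le0.
pose m := Num.min eps delta.
have m0 : 0 < m by rewrite lt_min eps0.
have m1 : m < 1 by rewrite gt_min delta1 orbT.
have lR : 0 < l%:R :> R by rewrite ltr0n.
pose L i := natceil (ln ((d i * d i.+1 * l)%N%:R / m)).
have LP i : (i < l)%N -> (0 < L i)%N /\ (d i * d i.+1 * l)%N%:R / m <= 4 ^+ L i.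
  move=> il; apply: log_width; rewrite ltr_pdivlMr// mul1r; apply: lt_le_trans m1 _.
  by rewrite ler1n !muln_gt0 d0 ?d0 ?l0// ltnW.
have Lbound i : (i < l)%N -> (d i * d i.+1)%:R / 4 ^+ L i <= m / l%:R.
  move=> il; have [_ Li] := LP i il.
  rewrite ler_pdivrMr ?exprn_gt0// mulrAC ler_pdivlMr//.
  by move: Li; rewrite ler_pdivrMr// natrM [m * _]mulrC.
have ndL i : (i < l)%N -> (15 * 1024 * d i * L i <= n i)%N.
  move=> il; rewrite nE// /width -(ler_nat R); apply: le_trans (natceil_ge _).
  by rewrite -!natrM ler_nat.
have := with_probability_at_least_forall
  (fun i : 'I_l => layer_probability AB_u AB_i (LP i (ltn_ord i)).1 (ndL i (ltn_ord i))).
apply: with_probability_at_leastW.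
  rewrite lerD2l lerN2.
  apply: (@le_trans _ _ (\sum_(i < l) m / l%:R)).
    by apply: ler_sum => i _; exact: Lbound.
  rewrite sumr_const card_ord -[_ *+ _]mulr_natl mulrC divfK ?gt_eqF//.
  by rewrite ge_min lexx orbT.
move=> w good f [W W1 ->].
have maskE i : exists SAB : 'M[bool]_(n i, d i) * 'M[bool]_(d i.+1, n i),
    (i < l)%N -> forall y : 'cV[R]_(d i),
    enorm (W i *m y - masked SAB.2 (\matrix_(a, b) B i a b w) *m
             relu (masked SAB.1 (\matrix_(a, b) A i a b w) *m y)) <=
    m / (4 * l%:R) * enorm y.
  (* Masks are chosen for every index; those from [l] on are arbitrary. *)
  case: (ltnP i l) => il; last by exists (const_mx false, const_mx false).
  have [SAB SABP] := good (Ordinal il) (W i) (W1 i il).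
  exists SAB => _ y; apply: le_trans (SABP y) _.
  rewrite ler_wpM2r ?enorm_ge0// [4 * 4 ^+ _]mulrC [4 * l%:R]mulrC !invfM !mulrA.
  by rewrite ler_pM2r ?invr_gt0//; exact: Lbound.
pose SAB i := sval (cid (maskE i)).
exists (fun i => (SAB i).1), (fun i => (SAB i).2).
have e0 : 0 <= m / (4 * l%:R) by rewrite divr_ge0 ?mulr_ge0 ?ltW.
have le2 : l%:R * (2 * (m / (4 * l%:R))) = m / 2 by field; rewrite gt_eqF.
apply: (@le_lt_trans _ _ (m / 2)%:E).
  apply: ge_ereal_sup => _ [x x1 <-]; rewrite lee_fin -le2.
  apply: (network_approx e0 _ W1 _ x1 (leqnn l)).2; first by rewrite le2; lra.
  by move=> i il y; exact: (svalP (cid (maskE i))).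
rewrite lte_fin; apply: lt_le_trans (_ : m <= eps); first by lra.
by rewrite ge_min lexx.
Qed.
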